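(* Let $p>2$ be a prime. Suppose $1\le i,j,l\le p-1$. The following are equivalent: (i) $V_l$ is a summand of $V_i\otimes V_j$; (ii) $V_i$ is a summand of $V_j\otimes V_l$; (iii) $V_j$ is a summand of $V_l\otimes V_i$; (iv) $i+j+l\equiv1\pmod 2$, $i+j+l<2p$, and $l<i+j$, $i<j+l$ and $j<l+i$. In particular, for each $n\in[p-1]$ the matrix $A^{(n)}$ is symmetric.
   Context: $k$ is an algebraically closed field of characteristic $p$, $G=\mathrm{SL}_2(\mathbb{F}_p)$, $[r]=\{1,\dots,r\}$. For $n\ge1$, $V_n$ is the $n$-dimensional $kG$-module of homogeneous polynomials over $k$ of degree $n-1$ in $X,Y$, where $\begin{pmatrix}a&b\\c&d\end{pmatrix}$ acts by $f(X,Y)\mapsto f(aX+cY,bX+dY)$. ''Summand'' means isomorphic to a direct summand as $kG$-modules. $A^{(n)}$ is the $(p-1)\times(p-1)$ matrix whose $(i,j)$ entry is the multiplicity of $V_j$ as an indecomposable direct summand of $V_i\otimes V_n$. *)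

(* Defs.v *)
From HB Require Import structures.
From Stdlib Require Import ClassicalEpsilon.
From mathcomp Require Import all_boot all_order all_algebra.
From mathcomp Require Import all_fingroup mxrepresentation character.
From mathcomp Require Import mpoly.

Set Implicit Arguments.
Unset Strict Implicit.
Unset Printing Implicit Defensive.

Import GRing.Theory.
Local Open Scope ring_scope.

Definition SL2_set (p : nat) : {set {'GL_2(p)}} :=
  [set g : {'GL_2(p)} | \det (GLval g) == 1].

Lemma SL2_group_set (p : nat) : group_set (SL2_set p).
Proof.
apply/group_setP; split=> [|x y]; first by rewrite inE GL_1E det1.
by rewrite !inE GL_MxE det_mulmx => /eqP-> /eqP->; rewrite mulr1.
Qed.

Definition SL2 (p : nat) : {group {'GL_2(p)}} := group (SL2_group_set p).

(* A kG-module is given by a homomorphism rho : G -> GL_n(k).  The modules in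
   play are left modules, so rho(g) is the matrix of g on column coordinate
   vectors.  mx_rsim (simultaneous conjugacy), dadd_grepr (block sum) and
   prod_repr (Kronecker product) depend only on rho. *)
Section Modules.

Variables (k : fieldType) (gT : finGroupType) (G : {group gT}).
Implicit Types L M N : representation k G.

Definition tensor M N : representation k G := Representation (prod_repr M N).

Definition summand L M : Prop :=
  exists N : representation k G, mx_rsim M (dadd_grepr L N).

Definition indecomposable M : Prop :=
  (0 < rdegree M)%N /\
  forall N1 N2 : representation k G, mx_rsim M (dadd_grepr N1 N2) ->
    rdegree N1 = 0%N \/ rdegree N2 = 0%N.

Definition is_multiplicity L M (m : nat) : Prop :=
  exists (r : nat) (W : 'I_r -> representation k G) (I : {set 'I_r}),
    [/\ forall t, indecomposable (W t),
        mx_rsim M (\big[dadd_grepr/grepr0]_(t < r) W t),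
        forall t, t \in I <-> mx_rsim (W t) L
      & #|I| = m].

(* The number m with [is_multiplicity L M m] exists and is unique by the
   Krull-Schmidt theorem. *)
Definition multiplicity L M : nat :=
  epsilon (inhabits 0%N) (is_multiplicity L M).

End Modules.

Section HomogeneousPolynomials.

Variables (k : fieldType) (p : nat).

(* A ring homomorphism as soon as k has characteristic p. *)
Definition of_Fp (a : 'F_p) : k := (a : nat)%:R.

(* (X, Y) |-> (X, Y) *m g, that is X |-> aX + cY and Y |-> bX + dY for
   g = [a b; c d]. *)
Definition linear_subst (g : 'M['F_p]_2) : 2.-tuple {mpoly k[2]} :=
  [tuple \sum_(r < 2) of_Fp (g r s) *: 'X_r | s < 2].

Definition act (g : 'M['F_p]_2) (f : {mpoly k[2]}) : {mpoly k[2]} :=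
  f \mPo linear_subst g.

(* X^(n-1-j) Y^j, for j < n *)
Definition mon (n : nat) (j : 'I_n) : 'X_{1..2} :=
  [multinom [tuple (n.-1 - j)%N; j : nat]].

Definition V_mx (n : nat) (g : {'GL_2(p)}) : 'M[k]_n :=
  \matrix_(i < n, j < n) (act (GLval g) 'X_[mon j])@_(mon i).

Lemma mon_inj n : injective (@mon n).
Proof.
move=> i j /(congr1 (fun m : 'X_{1..2} => m (@Ordinal 2 1 isT))).
by rewrite !multinomE /= => /val_inj.
Qed.

Lemma mdeg_mon n (j : 'I_n) : mdeg (mon j) = n.-1.
Proof.
case: n j => [[] //|n] j.
by rewrite mdegE !big_ord_recl big_ord0 !multinomE /= addn0 subnK // -ltnS.
Qed.

Lemma homog_expand n (f : {mpoly k[2]}) : (0 < n)%N -> f \is n.-1.-homog ->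
  f = \sum_(i < n) f@_(mon i) *: 'X_[mon i].
Proof.
move=> n_gt0 hf; apply/mpolyP=> m; rewrite raddf_sum /=.
have [dm|dm] := eqVneq (mdeg m) n.-1; last first.
  rewrite (dhomog_nemf_coeff hf dm) big1 // => i _.
  rewrite mcoeffZ mcoeffX; case: eqP => [mE|]; last by rewrite mulr0.
  by rewrite -mE mdeg_mon eqxx in dm.
have m1 : (m (@Ordinal 2 1 isT) < n)%N.
  rewrite -(prednK n_gt0) ltnS -dm mdegE (bigD1 (@Ordinal 2 1 isT)) //=.
  exact: leq_addr.
have mE : m = mon (Ordinal m1).
  apply/mnmP=> i; move: dm; rewrite mdegE !big_ord_recl big_ord0 /= addn0 => dm.
  rewrite multinomE; case: i => [[|[|i]] Hi] //=.
    rewrite (tnth_nth 0%N) /= -dm.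
    rewrite (_ : lift ord0 ord0 = Ordinal (isT : 1 < 2)%N) ?addnK; last exact: val_inj.
    by congr (m _); apply: val_inj.
  by rewrite (tnth_nth 0%N) /=; congr (m _); apply: val_inj.
rewrite (bigD1 (Ordinal m1)) //= mcoeffZ -mE mcoeffX eqxx mulr1 big1 ?addr0 //.
move=> i ni; rewrite mcoeffZ mcoeffX [in X in _ == X]mE (inj_eq (@mon_inj n)).
by rewrite (negbTE ni) mulr0.
Qed.

Lemma act_homog n (g : 'M['F_p]_2) (j : 'I_n) : act g 'X_[mon j] \is n.-1.-homog.
Proof.
rewrite /act comp_mpolyX !big_ord_recl big_ord0 mulr1.
have sub_homog s : tnth (linear_subst g) s \is 1.-homog.
  rewrite tnth_mktuple; apply: rpred_sum => r _; apply: dhomogZ.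
  by rewrite dhomogX /= mdeg1.
have -> : n.-1 = (1 * mon j ord0 + 1 * mon j (lift ord0 ord0))%N.
  by rewrite -(mdeg_mon j) mdegE !big_ord_recl big_ord0 addn0 !mul1n.
by apply: dhomogM; apply: dhomogMn.
Qed.

Hypothesis charkp : p \in [pchar k].

Lemma of_Fp_nat (n : nat) : of_Fp n%:R = n%:R.
Proof.
have p_pr := pcharf_prime charkp.
by rewrite /of_Fp val_Fp_nat // (GRing.natr_mod_pchar charkp).
Qed.

Lemma of_FpD : {morph of_Fp : a b / a + b}.
Proof. by move=> a b; rewrite -[a]natr_Zp -[b]natr_Zp -natrD !of_Fp_nat natrD. Qed.

Lemma of_FpM : {morph of_Fp : a b / a * b}.
Proof. by move=> a b; rewrite -[a]natr_Zp -[b]natr_Zp -natrM !of_Fp_nat natrM. Qed.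

Lemma act1 f : act 1%:M f = f.
Proof.
rewrite /act -[RHS]comp_mpoly_id; congr (f \mPo _).
apply: eq_from_tnth => s; rewrite !tnth_mktuple (bigD1 s) //= big1 => [|r ns].
  by rewrite mxE eqxx (of_Fp_nat 1) scale1r addr0.
by rewrite mxE (negbTE ns) (of_Fp_nat 0) scale0r.
Qed.

Lemma actM g h f : act (g *m h) f = act g (act h f).
Proof.
rewrite /act (comp_mpolyEX f) (comp_mpolyEX f (linear_subst h)) linear_sum /=.
apply: eq_bigr => m _; rewrite linearZ /=; congr (_ *: _).
rewrite !comp_mpolyX rmorph_prod /=; apply: eq_bigr => s _.
rewrite rmorphXn /=; congr (_ ^+ _).
rewrite !tnth_mktuple linear_sum /=.
under [RHS]eq_bigr => r _ do
  rewrite linearZ /= comp_mpolyXU -tnth_nth tnth_mktuple scaler_sumr.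
rewrite exchange_big /=; apply: eq_bigr => r _.
rewrite mxE (big_morph of_Fp of_FpD (of_Fp_nat 0)) scaler_suml.
by apply: eq_bigr => t _; rewrite of_FpM scalerA mulrC.
Qed.

Lemma V_mx_repr (n : nat) : mx_repr (SL2 p) (V_mx n).
Proof.
split=> [|g h _ _]; apply/matrixP=> i j; rewrite !mxE.
  by rewrite GL_1E act1 mcoeffX (inj_eq (@mon_inj n)) eq_sym.
have n_gt0 : (0 < n)%N by apply: leq_ltn_trans (ltn_ord i).
rewrite GL_MxE actM {1}(homog_expand n_gt0 (act_homog (GLval h) j)).
rewrite /act (linear_sum (comp_mpoly _)) (linear_sum (mcoeff _)) /=.
apply: eq_bigr => t _.
by rewrite linearZ /= mcoeffZ !mxE mulrC.
Qed.

(* The matrices are taken in the basis [mon]; see [V_mxE]. *)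
Definition V (n : nat) : representation k (SL2 p) :=
  Representation (MxRepresentation (V_mx_repr n)).

Definition poly_of_coord (n : nat) (v : 'cV[k]_n) : {mpoly k[2]} :=
  \sum_(j < n) v j 0 *: 'X_[mon j].

Lemma V_mxE (n : nat) (g : {'GL_2(p)}) (v : 'cV[k]_n) :
  poly_of_coord (V n g *m v) = act (GLval g) (poly_of_coord v).
Proof.
case: n v => [|n] v.
  by rewrite /poly_of_coord !big_ord0 /act linear0.
rewrite /act [in RHS]/poly_of_coord linear_sum /=.
under [RHS]eq_bigr => j _ do
  rewrite linearZ /= -/(act _ _) (homog_expand (ltn0Sn n) (act_homog _ j)) scaler_sumr.
rewrite exchange_big /=; apply: eq_bigr => i _.
rewrite mxE scaler_suml; apply: eq_bigr => j _.
by rewrite mxE scalerA mulrC.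
Qed.

(* Rows and columns are numbered from 0, so index i stands for V_(i+1). *)
Definition A (n : nat) : 'M[nat]_p.-1 :=
  \matrix_(i < p.-1, j < p.-1)
    multiplicity (V j.+1) (tensor (V i.+1) (V n)).

End HomogeneousPolynomials.

(* Main.v *)
Require Import Defs.
From mathcomp Require Import all_boot all_order all_algebra.
From mathcomp Require Import all_fingroup mxrepresentation character.
From mathcomp Require Import mxtens mpoly ring zify.
From Stdlib Require Import Classical ClassicalEpsilon.

(** The proof computes the multiplicity of V_l in V_i (x) V_j, for every l < p,
    i < p and j <= p: it is 1 under the Clebsch-Gordan condition (iv) and 0
    otherwise.  That condition is symmetric in i, j and l, so the equivalence of
    (i)-(iv) and the symmetry of A^(n) both follow.

    When End(L) = k, the multiplicity of L in M is the rank of the pairing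
    Hom(L, M) x Hom(M, L) -> End(L) = k given by composition.  This rank is
    additive on direct sums ([has_mult_dadd], [has_mult_uniq]); it is positive
    exactly when L is a summand ([summandP]), and it counts the copies of L in
    any decomposition of M into indecomposables ([is_multiplicity_has_mult]).

    Three facts about the V_n determine it.
    - For n <= p the only endomorphisms of V_n are the scalars, and for m < n
      every homomorphism V_m -> V_n is 0 ([V_hom_entry]): a homomorphism is
      determined by the image of X^(m-1), which is fixed by all Y |-> Y + tX,
      hence a multiple of X^(n-1).  So V_l has multiplicity 1 in itself and 0 in
      any other V_n.
    - If p does not divide n, then V_2 (x) V_n = V_(n+1) + V_(n-1)
      ([V2_tensor]): the maps f |-> X (x) d_X f + Y (x) d_Y f and
      f |-> X (x) Yf - Y (x) Xf embed the two summands, and Euler's identity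
      produces a left inverse up to the factor n.
    - If l < p, then V_l has multiplicity 0 in N (x) V_p for every N
      ([has_mult_tensor0]): for V_l -> N (x) V_p -> V_l with composite the
      scalar c, the trace c * l is also the trace of the endomorphism of V_p
      obtained by a partial trace over N from the composite in the other order.
      The latter is a scalar, of trace divisible by p, so c = 0.

    Tensoring V_i (x) V_j with V_2 in two ways gives
      V_(i+1) (x) V_j + V_(i-1) (x) V_j = V_i (x) V_(j+1) + V_i (x) V_(j-1),
    so the multiplicities c(i, j) of V_l satisfy
      c(i+1, j) + c(i-1, j) = c(i, j+1) + c(i, j-1).
    Together with the boundary values c(0, j) = c(i, 0) = c(i, p) = 0 and
    c(1, j) = [j = l], this recursion determines them; the indicator of (iv)
    solves it ([clebsch_gordan_rec], [has_mult_tensor]). *)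

Set Implicit Arguments.
Unset Strict Implicit.
Unset Printing Implicit Defensive.

Import GRing.Theory.

(** * Kronecker products and partial traces *)

Section Kronecker.

Local Open Scope ring_scope.
Variable k : fieldType.

Lemma split_mxtens_index m n (i : 'I_m.+1) (j : 'I_n) :
  split (mxtens_index (i, j) : 'I_(n + m * n)) =
    if unlift ord0 i is Some i' then inr (mxtens_index (i', j)) else inl j.
Proof.
case: unliftP => [i'|] ->; rewrite -[RHS]unsplitK; congr split; apply: val_inj.
  by rewrite /= /bump /= add1n mulSn addnA.
by rewrite /= mul0n.
Qed.

Lemma trow_entry n1 m2 n2 (A : 'rV[k]_n1) (B : 'M_(m2, n2)) i j l :
  trow A B i (mxtens_index (j, l)) = A 0 j * B i l.
Proof.
elim: n1 A j => [|n1 IHn] A j; first by case: j.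
rewrite /= mxE split_mxtens_index; case: unliftP => [j'|] ->.
  by rewrite IHn mxE; congr (A _ _ * _); apply: val_inj.
by rewrite !mxE; congr (A _ _ * _); apply: val_inj.
Qed.

Lemma tprod_entry m1 n1 m2 n2 (A : 'M[k]_(m1, n1)) (B : 'M_(m2, n2)) i i' j j' :
  tprod A B (mxtens_index (i, i')) (mxtens_index (j, j')) = A i j * B i' j'.
Proof.
elim: m1 A i => [|m1 IHm] A i; first by case: i.
rewrite /= mxE split_mxtens_index; case: unliftP => [h|] ->.
  by rewrite IHm mxE; congr (A _ _ * _); apply: val_inj.
by rewrite trow_entry mxE; congr (A _ _ * _); apply: val_inj.
Qed.

Lemma mxtens_index_bij m n : bijective (@mxtens_index m n).
Proof.
by exists (@mxtens_unindex m n); [apply: mxtens_indexK | apply: mxtens_unindexK].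
Qed.

Lemma sum_mxtens (V : nmodType) m n (f : 'I_(m * n) -> V) :
  \sum_c f c = \sum_i \sum_j f (mxtens_index (i, j)).
Proof.
rewrite (reindex _ (onW_bij _ (mxtens_index_bij m n))) /= pair_bigA /=.
by apply: eq_bigr => -[].
Qed.

Definition ptrace m n (A : 'M[k]_(m * n)) : 'M[k]_n :=
  \matrix_(a, b) \sum_s A (mxtens_index (s, a)) (mxtens_index (s, b)).

Lemma mxtrace_ptrace m n (A : 'M[k]_(m * n)) : \tr (ptrace A) = \tr A.
Proof.
rewrite [RHS]sum_mxtens exchange_big /=.
by apply: eq_bigr => a _; rewrite mxE.
Qed.

Lemma tprodl_mul m n (U : 'M[k]_m) (X : 'M_(m * n)) s a c :
  (tprod U 1%:M *m X) (mxtens_index (s, a)) c =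
    \sum_t U s t * X (mxtens_index (t, a)) c.
Proof.
rewrite mxE sum_mxtens; apply: eq_bigr => t _.
rewrite (bigD1 a) //= big1 ?addr0 => [|b nb]; rewrite tprod_entry mxE.
  by rewrite eqxx mulr1.
by rewrite eq_sym (negbTE nb) mulr0 mul0r.
Qed.

Lemma mul_tprodl m n (U : 'M[k]_m) (X : 'M_(m * n)) s a c :
  (X *m tprod U 1%:M) c (mxtens_index (s, a)) =
    \sum_t X c (mxtens_index (t, a)) * U t s.
Proof.
rewrite mxE sum_mxtens; apply: eq_bigr => t _.
rewrite (bigD1 a) //= big1 ?addr0 => [|b nb]; rewrite tprod_entry mxE.
  by rewrite eqxx mulr1.
by rewrite (negbTE nb) !mulr0.
Qed.

Lemma tprodr_mul m n (U : 'M[k]_n) (X : 'M_(m * n)) s a c :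
  (tprod 1%:M U *m X) (mxtens_index (s, a)) c =
    \sum_b U a b * X (mxtens_index (s, b)) c.
Proof.
rewrite mxE sum_mxtens (bigD1 s) //= [X in _ + X]big1 ?addr0 => [|t nt].
  by apply: eq_bigr => b _; rewrite tprod_entry mxE eqxx mul1r.
by rewrite big1 // => b _; rewrite tprod_entry mxE eq_sym (negbTE nt) !mul0r.
Qed.

Lemma mul_tprodr m n (U : 'M[k]_n) (X : 'M_(m * n)) s a c :
  (X *m tprod 1%:M U) c (mxtens_index (s, a)) =
    \sum_b X c (mxtens_index (s, b)) * U b a.
Proof.
rewrite mxE sum_mxtens (bigD1 s) //= [X in _ + X]big1 ?addr0 => [|t nt].
  by apply: eq_bigr => b _; rewrite tprod_entry mxE eqxx mul1r.
by rewrite big1 // => b _; rewrite tprod_entry mxE (negbTE nt) mul0r mulr0.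
Qed.

(** As for the full trace, but only the factor that is traced out may be moved
    cyclically. *)
Lemma ptrace_cyclic m n (U : 'M[k]_m) (X : 'M_(m * n)) :
  ptrace (tprod U 1%:M *m X) = ptrace (X *m tprod U 1%:M).
Proof.
apply/matrixP=> a b; rewrite !mxE.
under eq_bigr => s _ do rewrite tprodl_mul.
under [RHS]eq_bigr => s _ do rewrite mul_tprodl.
by rewrite exchange_big; apply: eq_bigr => t _; apply: eq_bigr => s _; rewrite mulrC.
Qed.

Lemma ptrace_mull m n (U : 'M[k]_n) (X : 'M_(m * n)) :
  ptrace (tprod 1%:M U *m X) = U *m ptrace X.
Proof.
apply/matrixP=> a b; rewrite !mxE.
under eq_bigr => s _ do rewrite tprodr_mul.
by rewrite exchange_big; apply: eq_bigr => t _; rewrite mxE mulr_sumr.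
Qed.

Lemma ptrace_mulr m n (U : 'M[k]_n) (X : 'M_(m * n)) :
  ptrace (X *m tprod 1%:M U) = ptrace X *m U.
Proof.
apply/matrixP=> a b; rewrite !mxE.
under eq_bigr => s _ do rewrite mul_tprodr.
by rewrite exchange_big; apply: eq_bigr => t _; rewrite mxE mulr_suml.
Qed.

End Kronecker.

(** * Sums and tensor products of representations up to isomorphism *)

Section SumsAndTensors.

Local Open Scope ring_scope.
Variables (k : fieldType) (gT : finGroupType) (G : {group gT}).
Implicit Types L M N P : representation k G.

(** Associativity, commutativity and distributivity only permute the basis; this
    reduces each of them to a comparison of matrix entries. *)
Lemma mx_rsim_reindex (T : finType) M N
    (f : T -> 'I_(rdegree M)) (h : T -> 'I_(rdegree N)) :
    bijective f -> bijective h ->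
    (forall g x y, g \in G -> M g (f x) (f y) = N g (h x) (h y)) ->
  mx_rsim M N.
Proof.
move=> bijf bijh fh; have [f' fK f'K] := bijf; have [h' hK h'K] := bijh.
have eqd : rdegree M = rdegree N.
  by rewrite -[LHS]card_ord -(bij_eq_card bijf) (bij_eq_card bijh) card_ord.
pose B : 'M[k]_(rdegree M, rdegree N) := \matrix_(a, b) (h (f' a) == b)%:R.
exists B => // [|g Gg].
  apply/row_freeP; exists (\matrix_(b, a) (h (f' a) == b)%:R).
  apply/matrixP=> a a'; rewrite !mxE (bigD1 (h (f' a))) //= !mxE eqxx mul1r.
  rewrite big1 ?addr0 => [|b nb]; last first.
    by rewrite !mxE [_ == b]eq_sym (negbTE nb) mul0r.
  by rewrite (inj_eq (can_inj hK)) (inj_eq (can_inj f'K)) eq_sym.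
apply/matrixP=> a b; rewrite !mxE (bigD1 (f (h' b))) //= !mxE fK h'K eqxx mulr1.
rewrite big1 => [|c nc]; last first.
  rewrite !mxE; case: eqP => [Eb|]; last by rewrite mulr0.
  by rewrite -Eb hK f'K eqxx in nc.
rewrite (bigD1 (h (f' a))) //= mxE eqxx mul1r.
rewrite [X in _ = _ + X]big1 => [|c nc]; last first.
  by rewrite !mxE [_ == c]eq_sym (negbTE nc) mul0r.
by rewrite !addr0 -{1}[a]f'K fh // h'K.
Qed.

Lemma tensor_entry M N g i i' j j' :
  tensor M N g (mxtens_index (i, i')) (mxtens_index (j, j')) = M g i j * N g i' j'.
Proof. exact: tprod_entry. Qed.

Lemma tensorC M N : mx_rsim (tensor M N) (tensor N M).
Proof.
pose f (x : 'I_(rdegree M) * 'I_(rdegree N)) : 'I_(rdegree (tensor M N)) :=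
  mxtens_index x.
pose h (x : 'I_(rdegree M) * 'I_(rdegree N)) : 'I_(rdegree (tensor N M)) :=
  mxtens_index (x.2, x.1).
apply: (@mx_rsim_reindex _ _ _ f h).
- exact: mxtens_index_bij.
- apply: bij_comp (mxtens_index_bij _ _) _.
  by exists (fun x => (x.2, x.1)); case.
by move=> g [i i'] [j j'] _; rewrite !tensor_entry mulrC.
Qed.

Lemma tensorA M N P : mx_rsim (tensor (tensor M N) P) (tensor M (tensor N P)).
Proof.
pose f (x : 'I_(rdegree M) * 'I_(rdegree N) * 'I_(rdegree P)) :
  'I_(rdegree (tensor (tensor M N) P)) := mxtens_index (mxtens_index x.1, x.2).
pose h (x : 'I_(rdegree M) * 'I_(rdegree N) * 'I_(rdegree P)) :
  'I_(rdegree (tensor M (tensor N P))) :=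
    mxtens_index (x.1.1, mxtens_index (x.1.2, x.2)).
apply: (@mx_rsim_reindex _ _ _ f h).
- apply: bij_comp (mxtens_index_bij _ _) _.
  exists (fun x => (@mxtens_unindex _ _ x.1, x.2)) => -[i j] /=.
    by rewrite mxtens_indexK.
  by congr (_, _); apply: mxtens_unindexK.
- apply: bij_comp (mxtens_index_bij _ _) _.
  exists (fun x => ((x.1, (@mxtens_unindex _ _ x.2).1), (@mxtens_unindex _ _ x.2).2))
    => [[[i j] l]|[i j]].
    by rewrite mxtens_indexK.
  by case: (mxtens_indexP j) => j1 j2; rewrite mxtens_indexK.
by move=> g [[i1 i2] i3] [[j1 j2] j3] _; rewrite !tensor_entry mulrA.
Qed.

Lemma dadd_entry M N g (x y : 'I_(rdegree M) + 'I_(rdegree N)) :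
  dadd_grepr M N g (unsplit x) (unsplit y) =
    match x, y with
    | inl i, inl j => M g i j | inr i, inr j => N g i j | _, _ => 0
    end.
Proof.
case: x y => i [] j; rewrite ?block_mxEul ?block_mxEur ?block_mxEdl ?block_mxEdr //.
all: by rewrite mxE.
Qed.

Lemma unsplit_bij m n : bijective (@unsplit m n).
Proof. by exists (@split m n); [exact: unsplitK | exact: splitK]. Qed.

Lemma tensorDl M N P :
  mx_rsim (tensor (dadd_grepr M N) P) (dadd_grepr (tensor M P) (tensor N P)).
Proof.
pose T := (('I_(rdegree M) + 'I_(rdegree N)) * 'I_(rdegree P))%type.
pose f (x : T) :
  'I_(rdegree (tensor (dadd_grepr M N) P)) := mxtens_index (unsplit x.1, x.2).
pose d (x : T) : 'I_(rdegree (tensor M P)) + 'I_(rdegree (tensor N P)) :=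
  match x.1 with
  | inl i => inl (mxtens_index (i, x.2))
  | inr i => inr (mxtens_index (i, x.2))
  end.
pose h (x : T) : 'I_(rdegree (dadd_grepr (tensor M P) (tensor N P))) := unsplit (d x).
apply: (@mx_rsim_reindex _ _ _ f h).
- apply: bij_comp (mxtens_index_bij _ _) _.
  exists (fun x => (split x.1, x.2)) => -[i j] /=; first by rewrite unsplitK.
  by rewrite splitK.
- apply: bij_comp (unsplit_bij _ _) _.
  pose d' (x : 'I_(rdegree M * rdegree P) + 'I_(rdegree N * rdegree P)) : T :=
    match x with
    | inl c => (inl (@mxtens_unindex _ _ c).1, (@mxtens_unindex _ _ c).2)
    | inr c => (inr (@mxtens_unindex _ _ c).1, (@mxtens_unindex _ _ c).2)
    end.
  exists d'.
    case=> [[i|i] j].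
      by transitivity (let u := @mxtens_unindex (rdegree M) _ (mxtens_index (i, j)) in
        (inl u.1, u.2) : T); last by rewrite mxtens_indexK.
    by transitivity (let u := @mxtens_unindex (rdegree N) _ (mxtens_index (i, j)) in
      (inr u.1, u.2) : T); last by rewrite mxtens_indexK.
  by move=> [c|c]; [congr (inl _) | congr (inr _)]; apply: mxtens_unindexK.
move=> g [x i] [y j] _.
rewrite tensor_entry [LHS](congr1 (fun z => z * _) (dadd_entry _ _ _)).
by rewrite dadd_entry /d; case: x y => x [] y; rewrite /= ?tensor_entry ?mul0r.
Qed.

Lemma dadd_greprA M N P :
  mx_rsim (dadd_grepr (dadd_grepr M N) P) (dadd_grepr M (dadd_grepr N P)).
Proof.
pose T := ('I_(rdegree M) + 'I_(rdegree N) + 'I_(rdegree P))%type.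
pose f (x : T) : 'I_(rdegree (dadd_grepr (dadd_grepr M N) P)) :=
  unsplit (match x with inl y => inl (unsplit y) | inr z => inr z end).
pose h (x : T) : 'I_(rdegree (dadd_grepr M (dadd_grepr N P))) :=
  unsplit (match x with
           | inl (inl y) => inl y
           | inl (inr y) => inr (unsplit (inl y))
           | inr z => inr (unsplit (inr z))
           end).
apply: (@mx_rsim_reindex _ _ _ f h).
- apply: bij_comp (unsplit_bij _ _) _.
  exists (fun x => match x with inl y => inl (split y) | inr z => inr z end).
    by case=> [y|z] //; rewrite unsplitK.
  by case=> [y|z] //; rewrite splitK.
- apply: bij_comp (unsplit_bij _ _) _.
  exists (fun x => match x with
            | inl y => inl (inl y)
            | inr z => match split z with inl y => inl (inr y) | inr y => inr y end
            end).
    by case=> [[y|y]|z] //; rewrite unsplitK.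
  by case=> [y|z] //; rewrite -{2}[z]splitK; case: split.
move=> g [[x|x]|x] [[y|y]|y] _; rewrite !dadd_entry ?(dadd_entry g (inl _) (inl _)) //.
all: by rewrite ?(dadd_entry g (inl _) (inr _)) ?(dadd_entry g (inr _) (inl _))
  ?(dadd_entry g (inr _) (inr _)).
Qed.

Lemma rsim_dadd M M' N N' : mx_rsim M M' -> mx_rsim N N' ->
  mx_rsim (dadd_grepr M N) (dadd_grepr M' N').
Proof.
case=> B dM freeB homB [C dN freeC homC].
exists (block_mx B 0 0 C) => [||g Gg]; first by rewrite /= dM dN.
  case/row_freeP: freeB => B' BB'; case/row_freeP: freeC => C' CC'.
  apply/row_freeP; exists (block_mx B' 0 0 C').
  by rewrite mulmx_block !(mulmx0, mul0mx, addr0, add0r) BB' CC' -scalar_mx_block.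
by rewrite /= !mulmx_block !(mulmx0, mul0mx, addr0, add0r) homB // homC.
Qed.

Lemma rsim_tensor M M' N N' : mx_rsim M M' -> mx_rsim N N' ->
  mx_rsim (tensor M N) (tensor M' N').
Proof.
case=> B dM freeB homB [C dN freeC homC].
exists (tprod B C) => [||g Gg]; first by rewrite /= dM dN.
  case/row_freeP: freeB => B' BB'; case/row_freeP: freeC => C' CC'.
  apply/row_freeP; exists (tprod B' C').
  by rewrite -tprodE BB' CC' tprod1.
by rewrite /= -!tprodE homB // homC.
Qed.

End SumsAndTensors.

(** * Multiplicity as the rank of the composition pairing *)

Section Multiplicity.

Local Open Scope ring_scope.
Variables (k : fieldType) (gT : finGroupType) (G : {group gT}).
Implicit Types L M N P : representation k G.

(** On row vectors F is a map M -> N.  The same F acts on column vectors, the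
    coordinates in which V_n is defined, as a map from N to M. *)
Definition is_hom M N (F : 'M[k]_(rdegree M, rdegree N)) : Prop :=
  {in G, forall g, M g *m F = F *m N g}.
Arguments is_hom : clear implicits.

Lemma is_hom1 M : is_hom M M 1%:M.
Proof. by move=> g _; rewrite mulmx1 mul1mx. Qed.

Lemma is_homM M N P F E : is_hom M N F -> is_hom N P E -> is_hom M P (F *m E).
Proof. by move=> homF homE g Gg; rewrite mulmxA homF // -!mulmxA homE. Qed.

Lemma is_homB M N F E : is_hom M N F -> is_hom M N E -> is_hom M N (F - E).
Proof. by move=> homF homE g Gg; rewrite mulmxBr mulmxBl homF // homE. Qed.

Lemma is_homZ M N a F : is_hom M N F -> is_hom M N (a *: F).
Proof. by move=> homF g Gg; rewrite -scalemxAr -scalemxAl homF. Qed.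

Lemma is_hom_sum M N (I : finType) F :
  (forall i : I, is_hom M N (F i)) -> is_hom M N (\sum_i F i).
Proof.
move=> homF g Gg; rewrite mulmx_sumr mulmx_suml.
by apply: eq_bigr => i _; apply: homF.
Qed.

Lemma is_hom_row L M N F E :
  is_hom L (dadd_grepr M N) (row_mx F E) <-> is_hom L M F /\ is_hom L N E.
Proof.
have eqFE g : (L g *m row_mx F E = row_mx F E *m dadd_grepr M N g) <->
    (L g *m F = F *m M g /\ L g *m E = E *m N g).
  rewrite /= mul_mx_row mul_row_block !mulmx0 addr0 add0r.
  by split=> [/eq_row_mx|[-> ->]].
split=> [homFE|[homF homE] g Gg]; last by apply/eqFE; rewrite homF // homE.
by split=> g /homFE /eqFE[].
Qed.

Lemma is_hom_col L M N F E :
  is_hom (dadd_grepr M N) L (col_mx F E) <-> is_hom M L F /\ is_hom N L E.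
Proof.
have eqFE g : (dadd_grepr M N g *m col_mx F E = col_mx F E *m L g) <->
    (M g *m F = F *m L g /\ N g *m E = E *m L g).
  rewrite /= mul_block_col !mul0mx addr0 add0r mul_col_mx.
  by split=> [/eq_col_mx|[-> ->]].
split=> [homFE|[homF homE] g Gg]; last by apply/eqFE; rewrite homF // homE.
by split=> g /homFE /eqFE[].
Qed.

Lemma is_hom0 M N : is_hom M N 0.
Proof. by move=> g _; rewrite mulmx0 mul0mx. Qed.

Lemma rsim_daddr0 M N : rdegree N = 0%N -> mx_rsim (dadd_grepr M N) M.
Proof.
case: N => n N /= n0; subst n; exists (col_mx 1%:M 0); first by rewrite /= addn0.
  apply/row_freeP; exists (row_mx 1%:M 0).
  rewrite mul_col_row !(mulmx1, mul0mx) [RHS]scalar_mx_block.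
  by congr block_mx; apply/matrixP=> i j; first [by case: i | by case: j].
have : is_hom (dadd_grepr M (Representation N)) M (col_mx 1%:M 0).
  by apply/is_hom_col; split; [apply: is_hom1 | apply: is_hom0].
by [].
Qed.

Lemma rsim_daddl0 M N : rdegree N = 0%N -> mx_rsim (dadd_grepr N M) M.
Proof.
case: N => n N /= n0; subst n; exists (col_mx 0 1%:M) => //.
  apply/row_freeP; exists (row_mx 0 1%:M).
  rewrite mul_col_row !(mulmx1, mulmx0) [RHS]scalar_mx_block.
  by congr block_mx; apply/matrixP=> i j; first [by case: i | by case: j].
have : is_hom (dadd_grepr (Representation N) M) M (col_mx 0 1%:M).
  by apply/is_hom_col; split; [apply: is_hom0 | apply: is_hom1].
by [].
Qed.

Lemma rsim_homs M N : mx_rsim M N ->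
  exists B C, [/\ is_hom M N B, is_hom N M C, B *m C = 1%:M & C *m B = 1%:M].
Proof.
case: M N => m M [n N] /=; case=> B eq_mn; rewrite /is_hom /= in B *.
case: n / eq_mn N B => N B; rewrite row_free_unit => uB homB.
exists B, (invmx B); split=> //; rewrite ?mulmxV ?mulVmx // => g Gg.
by apply: canRL (mulKmx uB) _; rewrite mulmxA -homB // mulmxK.
Qed.

Definition biorthogonal L M (I : finType) (F : I -> 'M_(rdegree L, rdegree M))
    (H : I -> 'M_(rdegree M, rdegree L)) : Prop :=
  [/\ forall a, is_hom L M (F a), forall a, is_hom M L (H a)
    & forall a b, F a *m H b = (a == b)%:R%:M].

(** For a biorthogonal family, the projection onto a complement of the copies of L
    that it splits off. *)
Definition defect L M (I : finType) (F : I -> 'M_(rdegree L, rdegree M))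
    (H : I -> 'M_(rdegree M, rdegree L)) : 'M[k]_(rdegree M) :=
  1%:M - \sum_a H a *m F a.

(** The pairing of Hom(L, M) with Hom(M, L) has rank r: r pairs in duality are
    split off, and the pairing vanishes on the complement. *)
Definition has_mult L M (r : nat) : Prop :=
  exists (I : finType) (F : I -> 'M_(rdegree L, rdegree M))
         (H : I -> 'M_(rdegree M, rdegree L)),
    [/\ biorthogonal F H, #|I| = r
      & forall F' H', is_hom L M F' -> is_hom M L H' -> F' *m defect F H *m H' = 0].

Lemma defect_hom L M (I : finType) (F : I -> 'M_(rdegree L, rdegree M))
  (H : I -> 'M_(rdegree M, rdegree L)) : biorthogonal F H -> is_hom M M (defect F H).
Proof.
case=> homF homH _; apply: is_homB; first exact: is_hom1.
by apply: is_hom_sum => a; apply: is_homM.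
Qed.

Lemma has_mult_rsim L M N r : mx_rsim M N -> has_mult L M r -> has_mult L N r.
Proof.
case/rsim_homs=> B [C [homB homC BC CB]] [I [F [H [[homF homH FH] dI def]]]].
exists I, (fun a => F a *m B), (fun a => C *m H a); split=> //.
  split=> [a|a|a b]; [exact: is_homM | exact: is_homM |].
  by rewrite mulmxA -(mulmxA (F a)) BC mulmx1.
move=> F' H' homF' homH'.
have -> : defect (fun a => F a *m B) (fun a => C *m H a) = C *m defect F H *m B.
  rewrite /defect mulmxBr mulmxBl mulmx1 CB mulmx_sumr mulmx_suml.
  by congr (_ - _); apply: eq_bigr => a _; rewrite !mulmxA.
have := def _ _ (is_homM homF' homC) (is_homM homB homH').
by rewrite !mulmxA.
Qed.

Lemma sum_block_diag m n (I : finType) (X : I -> 'M[k]_m) (Y : I -> 'M[k]_n) :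
  \sum_a block_mx (X a) 0 0 (Y a) = block_mx (\sum_a X a) 0 0 (\sum_a Y a).
Proof.
elim/big_rec3: _ => [|a x y u _ ->]; last by rewrite add_block_mx !addr0.
by rewrite block_mx0.
Qed.

Lemma has_mult_dadd L M N r s :
  has_mult L M r -> has_mult L N s -> has_mult L (dadd_grepr M N) (r + s).
Proof.
case=> [I [F [H [[homF homH FH] dI def]]]] [J [E [K [[homE homK EK] dJ defJ]]]].
pose m := rdegree M; pose n := rdegree N; pose l := rdegree L.
pose F2 (x : I + J) : 'M[k]_(l, m + n) :=
  match x with inl a => row_mx (F a) 0 | inr b => row_mx 0 (E b) end.
pose H2 (x : I + J) : 'M[k]_(m + n, l) :=
  match x with inl a => col_mx (H a) 0 | inr b => col_mx 0 (K b) end.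
exists (I + J)%type, F2, H2; split=> [||F' H']; last 1 first.
- have -> : @defect L (dadd_grepr M N) _ F2 H2 = block_mx (defect F H) 0 0 (defect E K).
    rewrite /defect big_sumType /= scalar_mx_block.
    under eq_bigr => a _ do rewrite mul_col_row !(mulmx0, mul0mx).
    under [X in _ - (_ + X)]eq_bigr => a _ do rewrite mul_col_row !(mulmx0, mul0mx).
    rewrite !sum_block_diag !sumr_const !mul0rn add_block_mx !addr0 add0r.
    by rewrite opp_block_mx add_block_mx !subr0.
  rewrite -[F'](@hsubmxK _ _ m n) -[H'](@vsubmxK _ m n).
  case/is_hom_row=> homl homr /is_hom_col[homu homd].
  by rewrite mul_row_block !mulmx0 addr0 add0r mul_row_col def // defJ // addr0.
- split=> [[a|b]|[a|b]|[a|a] [b|b]].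
  + by apply/is_hom_row; split; [apply: homF | apply: is_hom0].
  + by apply/is_hom_row; split; [apply: is_hom0 | apply: homE].
  + by apply/is_hom_col; split; [apply: homH | apply: is_hom0].
  + by apply/is_hom_col; split; [apply: is_hom0 | apply: homK].
  + by rewrite mul_row_col mulmx0 addr0 FH.
  + by rewrite mul_row_col mulmx0 mul0mx addr0 raddf0.
  + by rewrite mul_row_col mulmx0 mul0mx addr0 raddf0.
  + by rewrite mul_row_col mulmx0 add0r EK.
- by rewrite card_sum dI dJ.
Qed.

Section ScalarEndomorphisms.

Variable L : representation k G.
Hypothesis L_gt0 : (0 < rdegree L)%N.
Hypothesis endL : forall F, is_hom L L F -> is_scalar_mx F.

Let z : 'I_(rdegree L) := Ordinal L_gt0.

Lemma end_entry F : is_hom L L F -> F = (F z z)%:M.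
Proof. by case/endL/is_scalar_mxP=> c ->; rewrite mxE eqxx. Qed.

(** The duality matrix of F and H, an identity matrix of size #|I|, factors
    through k^r: on homomorphisms the defect contributes nothing. *)
Lemma biorthogonal_card M r (I : finType) (F : I -> 'M_(rdegree L, rdegree M))
    (H : I -> 'M_(rdegree M, rdegree L)) :
  has_mult L M r -> biorthogonal F H -> (#|I| <= r)%N.
Proof.
case=> J [E [K [[homE homK _] <- def]]] [homF homH FH].
pose C : 'M_(#|I|, #|J|) := \matrix_(a, b) (F (enum_val a) *m K (enum_val b)) z z.
pose D : 'M_(#|J|, #|I|) := \matrix_(b, a) (E (enum_val b) *m H (enum_val a)) z z.
have CD : C *m D = 1%:M.
  apply/matrixP=> a a'; rewrite mxE [RHS]mxE.
  have /eqP := def _ _ (homF (enum_val a)) (homH (enum_val a')).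
  rewrite mulmxBr mulmxBl mulmx1 subr_eq0 FH (inj_eq enum_val_inj).
  move/eqP/matrixP/(_ z z); rewrite mxE eqxx mulr1n => ->.
  rewrite mulmx_sumr mulmx_suml summxE.
  rewrite [RHS](reindex _ (onW_bij _ (enum_val_bij J))) /=.
  apply: eq_bigr => b _; rewrite [C _ _]mxE [D _ _]mxE mulmxA -mulmxA.
  rewrite [in RHS](end_entry (is_homM (homF _) (homK _))).
  by rewrite mul_scalar_mx [RHS]mxE.
have := mxrankM_maxr C D; rewrite CD mxrank1 => /leq_trans; apply.
exact: rank_leq_row.
Qed.

Lemma has_mult_uniq M r s : has_mult L M r -> has_mult L M s -> r = s.
Proof.
move=> mr ms; have [I [F [H [FH dI _]]]] := mr; have [J [E [K [EK dJ _]]]] := ms.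
apply/eqP; rewrite eqn_leq -{1}dI (biorthogonal_card ms FH) -dJ.
exact: biorthogonal_card mr EK.
Qed.

Lemma biorthogonal_bound M (I : finType) (F : I -> 'M_(rdegree L, rdegree M))
    (H : I -> 'M_(rdegree M, rdegree L)) :
  biorthogonal F H -> (#|I| <= rdegree M)%N.
Proof.
case=> _ _ FH.
pose C : 'M_(#|I|, rdegree M) := \matrix_(a, j) F (enum_val a) z j.
pose D : 'M_(rdegree M, #|I|) := \matrix_(j, a) H (enum_val a) j z.
have CD : C *m D = 1%:M.
  apply/matrixP=> a a'; rewrite mxE [RHS]mxE.
  have /matrixP/(_ z z) := FH (enum_val a) (enum_val a').
  rewrite mxE [in RHS]mxE eqxx mulr1n (inj_eq enum_val_inj) => <-.
  by apply: eq_bigr => j _; rewrite !mxE.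
have := mxrankM_maxr C D; rewrite CD mxrank1 => /leq_trans; apply.
exact: rank_leq_row.
Qed.

(** Composing with the defect e, an idempotent with F_a e = e H_a = 0, makes the
    new pair orthogonal to the old ones; rescaling then makes it dual. *)
Lemma biorthogonal_extend M (I : finType) (F : I -> 'M_(rdegree L, rdegree M))
    (H : I -> 'M_(rdegree M, rdegree L)) F' H' :
    biorthogonal F H -> is_hom L M F' -> is_hom M L H' ->
    F' *m defect F H *m H' <> 0 ->
  exists (F2 : option I -> _) H2, @biorthogonal L M _ F2 H2.
Proof.
move=> FHb homF' homH'; have [homF homH FH] := FHb.
set e := defect F H => FeH_neq0.
have home : is_hom M M e by apply: defect_hom FHb.
have homFeH := is_homM (is_homM homF' home) homH'.
have Fe a : F a *m e = 0.
  rewrite mulmxBr mulmx1 mulmx_sumr (bigD1 a) //= mulmxA FH eqxx mul1mx.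
  rewrite big1 ?addr0 ?subrr // => b nab.
  by rewrite mulmxA FH eq_sym (negbTE nab) raddf0 mul0mx.
have eH a : e *m H a = 0.
  rewrite mulmxBl mul1mx mulmx_suml (bigD1 a) //= -mulmxA FH eqxx mulmx1.
  rewrite big1 ?addr0 ?subrr // => b nab.
  by rewrite -mulmxA FH (negbTE nab) raddf0 mulmx0.
have ee : e *m e = e.
  rewrite {1}/e mulmxBl mul1mx mulmx_suml big1 ?subr0 // => b _.
  by rewrite -mulmxA Fe mulmx0.
pose c := (F' *m e *m H') z z.
have c_neq0 : c != 0.
  by apply/eqP=> c0; apply: FeH_neq0; rewrite (end_entry homFeH) -/c c0 raddf0.
exists (fun o => if o is Some a then F a else c^-1 *: (F' *m e)).
exists (fun o => if o is Some a then H a else e *m H').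
split=> [[a|]|[a|]|[a|] [b|]] //.
- by apply: is_homZ; apply: is_homM.
- exact: is_homM.
- by rewrite mulmxA Fe mul0mx raddf0.
- by rewrite -scalemxAl -mulmxA eH mulmx0 scaler0 raddf0.
- rewrite -scalemxAl -mulmxA (mulmxA e) ee mulmxA (end_entry homFeH) -/c.
  by rewrite eqxx scale_scalar_mx mulVf.
Qed.

(** When a biorthogonal family cannot be extended, the pairing vanishes on the
    complement; extensions stop because the degree of M bounds their size. *)
Lemma has_mult_exists M : exists r, has_mult L M r.
Proof.
suffices ind d : forall (I : finType) (F : I -> _) (H : I -> _),
    @biorthogonal L M I F H -> (rdegree M - #|I| <= d)%N -> exists r, has_mult L M r.
  apply: (ind (rdegree M) void (of_void _) (of_void _)); last exact: leq_subr.
  by split=> - [].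
elim: d => [|d IHd] I F H FH leId.
all: case: (classic (exists F' H',
  [/\ is_hom L M F', is_hom M L H' & F' *m defect F H *m H' <> 0])).
1,3: case=> F' [H' [homF' homH' neq0]].
1,2: have [F2 [H2 FH2]] := biorthogonal_extend FH homF' homH' neq0.
1,2: have := biorthogonal_bound FH2; rewrite card_option => ltI.
- by move: leId; rewrite leqn0 subn_eq0 leqNgt ltI.
- apply: IHd FH2 _; rewrite card_option subnS -ltnS prednK ?subn_gt0 //.
all: move=> nex; exists #|I|, I, F, H; split=> // F' H' homF' homH'.
all: by apply: NNPP => neq0; apply: nex; exists F', H'.
Qed.

Lemma has_mult_self : has_mult L L 1.
Proof.
exists unit, (fun=> 1%:M), (fun=> 1%:M); split=> [||F' H' _ _].
- by split=> [a|a|[] []]; rewrite ?mulmx1 ?eqxx //; apply: is_hom1.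
- exact: card_unit.
by rewrite /defect big_const card_unit /= mulmx1 addr0 subrr mulmx0 mul0mx.
Qed.

Lemma has_mult0P M :
  (forall F H, is_hom L M F -> is_hom M L H -> F *m H = 0) -> has_mult L M 0.
Proof.
move=> FH0; exists void, (of_void _), (of_void _); split=> [||F' H' homF' homH'].
- by split=> - [].
- exact: card_void.
by rewrite /defect big1 => [|[]]; rewrite subr0 mulmx1 FH0.
Qed.

(** The complement is the kernel of H, onto which 1 - H F projects. *)
Lemma split_summand M F H :
  is_hom L M F -> is_hom M L H -> F *m H = 1%:M -> summand L M.
Proof.
move=> homF homH FH.
have modV : mxmodule M (kermx H).
  apply/mxmoduleP=> g Gg; rewrite (sameP sub_kermxP eqP) -mulmxA homH //.
  by rewrite mulmxA mulmx_ker mul0mx.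
pose e := 1%:M - H *m F.
have eV : (e <= kermx H)%MS.
  by apply/sub_kermxP; rewrite mulmxBl mul1mx -mulmxA FH mulmx1 subrr.
exists (Representation (submod_repr modV)).
exists (row_mx H (in_submod (kermx H) e)) => [||g Gg] /=.
- have rH : \rank H = rdegree L.
    apply/eqP; rewrite eqn_leq rank_leq_col -{1}(mxrank1 k (rdegree L)) -FH.
    exact: mxrankM_maxr.
  by rewrite mxrank_ker rH subnKC // -rH rank_leq_row.
- apply/row_freeP; exists (col_mx F (val_submod 1%:M)).
  by rewrite mul_row_col -val_submodE in_submodK // addrC subrK.
rewrite mul_mx_row mul_row_block !mulmx0 addr0 add0r homH //; congr row_mx.
transitivity (in_submod (kermx H) (e *m M g)); last exact: (in_submodJ modV g eV).
rewrite (in_submodE _ e) (in_submodE _ (e *m M g)) mulmxA; congr (_ *m _).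
by rewrite /e mulmxBr mulmxBl mulmx1 mul1mx mulmxA homH // -!mulmxA homF.
Qed.

Lemma summandP M r : has_mult L M r -> summand L M <-> (0 < r)%N.
Proof.
move=> mr; split=> [[N simM]|r_gt0].
  have [s ms] := has_mult_exists N.
  have m1s := has_mult_rsim (mx_rsim_sym simM) (has_mult_dadd has_mult_self ms).
  by rewrite (has_mult_uniq mr m1s).
case: mr r_gt0 => I [F [H [[homF homH FH] <- _]]] /card_gt0P[a _].
by apply: (split_summand (homF a) (homH a)); rewrite FH eqxx.
Qed.

Lemma has_mult_indec W : indecomposable W -> ~ mx_rsim W L -> has_mult L W 0.
Proof.
case=> W_gt0 indW nWL; have [r mr] := has_mult_exists W.
have [r0|r_gt0] := posnP r; first by rewrite r0 in mr.
have [N simW] := iffRL (summandP mr) r_gt0.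
case: (indW _ _ simW) => d0; first by have := L_gt0; rewrite d0.
by case: nWL; apply: mx_rsim_trans simW _; apply: rsim_daddr0.
Qed.

Lemma is_multiplicity_has_mult M m : is_multiplicity L M m -> has_mult L M m.
Proof.
case=> r [W [I [indW simM IW <-]]]; apply: has_mult_rsim (mx_rsim_sym simM) _.
have -> : #|I| = (\sum_(t < r) (t \in I))%N by rewrite -sum1_card big_mkcond.
elim/big_rec2: _ => [|t s N _ ms].
  by apply: has_mult0P => F H _ _; rewrite thinmx0 mul0mx.
apply: has_mult_dadd ms; case: (boolP (t \in I)) => [/IW simL|tI].
  by apply: has_mult_rsim (mx_rsim_sym simL) has_mult_self.
by apply: has_mult_indec => // /IW; apply/negP.
Qed.

End ScalarEndomorphisms.

End Multiplicity.

Arguments is_hom {k gT G} M N F.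

(** * Decompositions into indecomposables *)

Section Decomposition.

Local Open Scope ring_scope.
Variables (k : fieldType) (gT : finGroupType) (G : {group gT}).
Implicit Types L M N P : representation k G.
Local Notation dsum s := (\big[dadd_grepr/grepr0]_(W <- s) W).

Lemma dsum_cat (s t : seq (representation k G)) :
  mx_rsim (dsum (s ++ t)) (dadd_grepr (dsum s) (dsum t)).
Proof.
elim: s => [|W s IHs]; rewrite ?cat_cons ?big_nil ?big_cons.
  by apply: mx_rsim_sym; apply: rsim_daddl0.
apply: mx_rsim_trans (mx_rsim_sym (dadd_greprA _ _ _)).
exact: rsim_dadd (mx_rsim_refl _) IHs.
Qed.

Lemma rsim_grepr0 M : rdegree M = 0%N -> mx_rsim M grepr0.
Proof.
case: M => m M /= m0; subst m; exists 1%:M => // [|g _].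
  by rewrite /row_free mxrank1.
by rewrite !thinmx0.
Qed.

Lemma indec_decomposition M : exists s : seq (representation k G),
  mx_rsim M (dsum s) /\ forall i, (i < size s)%N -> indecomposable (nth grepr0 s i).
Proof.
have [d] := ubnP (rdegree M); elim: d M => // d IHd M; rewrite ltnS => leMd.
have [M0|M_gt0] := posnP (rdegree M).
  by exists [::]; rewrite big_nil; split=> //; apply: rsim_grepr0.
have [indM|decM] := classic (indecomposable M).
  exists [:: M]; rewrite big_cons big_nil; split=> [|[]//].
  by apply: mx_rsim_sym; apply: rsim_daddr0.
have [N1 [N2 [simM N1_neq0 N2_neq0]]] : exists N1 N2,
    [/\ mx_rsim M (dadd_grepr N1 N2), rdegree N1 <> 0%N & rdegree N2 <> 0%N].
  apply: NNPP => nex; apply: decM; split=> // N1 N2 simM.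
  apply: NNPP => /not_or_and[N1n N2n]; apply: nex.
  by exists N1, N2.
have dM : rdegree M = (rdegree N1 + rdegree N2)%N by apply: mxrank_rsim simM.
move/eqP in N1_neq0; move/eqP in N2_neq0; rewrite -!lt0n in N1_neq0 N2_neq0.
have [|s1 [sim1 ind1]] := IHd N1.
  by apply: leq_trans leMd; rewrite dM -addn1 leq_add2l.
have [|s2 [sim2 ind2]] := IHd N2.
  by apply: leq_trans leMd; rewrite dM -addn1 addnC leq_add2r.
exists (s1 ++ s2); split.
  apply: mx_rsim_trans simM _; apply: mx_rsim_trans (mx_rsim_sym (dsum_cat _ _)).
  exact: rsim_dadd.
move=> i; rewrite size_cat nth_cat => lti; case: ltnP => [/ind1//|le1i].
by apply: ind2; rewrite ltn_subLR.
Qed.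

Lemma is_multiplicity_exists L M : exists m, is_multiplicity L M m.
Proof.
have [s [simM inds]] := indec_decomposition M.
pose W (t : 'I_(size s)) := nth grepr0 s t.
pose isoL t : bool :=
  if excluded_middle_informative (mx_rsim (W t) L) then true else false.
exists #|[set t | isoL t]|, (size s), W, [set t | isoL t]; split=> // [t||t].
- exact: inds.
- by rewrite (big_nth grepr0) big_mkord in simM.
by rewrite inE /isoL; case: excluded_middle_informative.
Qed.

Lemma multiplicity_has_mult L M m :
    (0 < rdegree L)%N -> (forall F, is_hom L L F -> is_scalar_mx F) ->
  has_mult L M m -> multiplicity L M = m.
Proof.
move=> L_gt0 endL mm; apply: has_mult_uniq mm => //.
apply: is_multiplicity_has_mult => //.
exact: epsilon_spec (is_multiplicity_exists L M).
Qed.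

End Decomposition.

(** * A vanishing criterion by partial traces *)

Section PartialTrace.

Local Open Scope ring_scope.
Variables (k : fieldType) (gT : finGroupType) (G : {group gT}).
Implicit Types L M N P : representation k G.

(** The action of g on N (x) P is (N g (x) 1) (1 (x) P g); the first factor is
    cancelled by cyclicity, the second passes through the partial trace. *)
Lemma ptrace_hom N P X :
  is_hom (tensor N P) (tensor N P) X -> is_hom P P (ptrace X : 'M_(rdegree P)).
Proof.
move=> homX g Gg; rewrite -ptrace_mull -ptrace_mulr.
have /= := homX g Gg.
pose T := tprod (N g) (1%:M : 'M_(rdegree P)).
pose T' := tprod (N (g^-1)%g) (1%:M : 'M_(rdegree P)).
pose S := tprod (1%:M : 'M_(rdegree N)) (P g).
have TS : T *m S = tprod (N g) (P g) by rewrite -tprodE mulmx1 mul1mx.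
have ST : S *m T = tprod (N g) (P g) by rewrite -tprodE mulmx1 mul1mx.
have T'T : T' *m T = 1%:M.
  by rewrite -tprodE mulmx1 -repr_mxM ?groupV // mulVg repr_mx1 tprod1.
have TT' : T *m T' = 1%:M.
  by rewrite -tprodE mulmx1 -repr_mxM ?groupV // mulgV repr_mx1 tprod1.
rewrite -{1}TS -ST -/S => eqX.
have -> : S *m X = T' *m (X *m S *m T).
  by rewrite -(mulmxA X S T) -eqX !mulmxA T'T mul1mx.
by rewrite ptrace_cyclic -(mulmxA _ T T') TT' mulmx1.
Qed.

(** For L -F-> N (x) P -H-> L, the endomorphism H *m F of N (x) P and its partial
    trace over N, a scalar b on P, have equal traces.  So the trace of the scalar
    F *m H on L is b times the degree of P, which is 0. *)
Lemma has_mult_tensor0 L N P :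
    (forall F, is_hom L L F -> is_scalar_mx F) ->
    (forall F, is_hom P P F -> is_scalar_mx F) ->
    (rdegree L)%:R != 0 :> k -> (rdegree P)%:R = 0 :> k ->
  has_mult L (tensor N P) 0.
Proof.
move=> endL endP L_neq0 P0; apply: has_mult0P => F H homF homH.
have /is_scalar_mxP[c FHc] := endL _ (is_homM homF homH).
have /is_scalar_mxP[b HFb] := endP _ (ptrace_hom (is_homM homH homF)).
have : \tr (F *m H) = 0.
  by rewrite mxtrace_mulC -mxtrace_ptrace HFb mxtrace_scalar -mulr_natr P0 mulr0.
rewrite FHc mxtrace_scalar -mulr_natr => /eqP.
by rewrite mulf_eq0 (negbTE L_neq0) orbF => /eqP->; rewrite raddf0.
Qed.

End PartialTrace.

(** * Homomorphisms between the modules V_n *)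

Local Notation act := Defs.act.

Section Homomorphisms.

Local Open Scope ring_scope.
Variables (k : fieldType) (p : nat).
Hypothesis charkp : p \in [pchar k].
Local Notation ofFp := (@of_Fp k p).

Lemma act_linear (g : 'M['F_p]_2) : linear (act g : {mpoly k[2]} -> _).
Proof. by move=> a f1 f2; rewrite /act linearP. Qed.

Lemma actX_expand n (g : 'M['F_p]_2) (j : 'I_n) :
  act g ('X_[mon j] : {mpoly k[2]}) =
    \sum_(i < n) (act g ('X_[mon j] : {mpoly k[2]}))@_(mon i) *: 'X_[mon i].
Proof.
have n_gt0 : (0 < n)%N by apply: leq_ltn_trans (ltn_ord j).
exact: homog_expand (act_homog k g j).
Qed.

(** Setting X = 1 loses nothing on homogeneous polynomials of a given degree, and
    it makes the entries of the action on V_n coefficients of one-variable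
    polynomials. *)
Definition dehom (f : {mpoly k[2]}) : {poly k} :=
  mmap polyC (fun i => if i == 0 :> 'I_2 then 1 else 'X) f.

Lemma dehom_mon n (i : 'I_n) : dehom 'X_[mon i] = 'X^i.
Proof.
rewrite /dehom mmapX /mmap1 big_ord_recl big_ord_recl big_ord0 /= expr1n mul1r mulr1.
by rewrite !multinomE (tnth_nth 0%N).
Qed.

Lemma V_mx_coef n (g : {'GL_2(p)}) (i j : 'I_n) :
  V_mx k n g i j =
    (((ofFp (g 0 0))%:P + ofFp (g 1 0) *: 'X) ^+ (n.-1 - j) *
     ((ofFp (g 0 1))%:P + ofFp (g 1 1) *: 'X) ^+ j)`_i.
Proof.
have := congr1 dehom (actX_expand (GLval g) j).
rewrite {2}/dehom (raddf_sum (mmap _ _)) /=.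
under eq_bigr => t _ do rewrite mmapZ -/(dehom _) dehom_mon mul_polyC.
have -> : dehom (act (GLval g) 'X_[mon j]) =
    ((ofFp (g 0 0))%:P + ofFp (g 1 0) *: 'X) ^+ (n.-1 - j) *
     ((ofFp (g 0 1))%:P + ofFp (g 1 1) *: 'X) ^+ j.
  rewrite /act comp_mpolyX !big_ord_recl big_ord0 mulr1 /dehom rmorphM !rmorphXn /=.
  rewrite !tnth_mktuple !multinomE !(tnth_nth 0%N) /=.
  rewrite !big_ord_recl !big_ord0 !addr0 !rmorphD /= !mmapZ !mmapX !mmap1U /=.
  rewrite !mulr1 !mul_polyC.
  have -> : lift ord0 ord0 = 1 :> 'I_2 by apply: val_inj.
  by [].
move->; rewrite coef_sum (bigD1 i) //= big1 => [|t nt]; rewrite coefZ coefXn.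
  by rewrite eqxx mulr1 addr0 mxE.
by rewrite eq_sym (inj_eq val_inj) (negbTE nt) mulr0.
Qed.

Definition mx22 (F : pzRingType) (a b c d : F) : 'M[F]_2 :=
  \matrix_(i, j) if i == 0 then (if j == 0 then a else b)
                 else (if j == 0 then c else d).

Lemma SL2_elt (a b c d : 'F_p) : a * d - b * c = 1 ->
  exists2 g : {'GL_2(p)}, g \in SL2 p & GLval g = mx22 a b c d.
Proof.
move=> det1; have detm : \det (mx22 a b c d) = 1.
  rewrite -det1 (expand_det_row _ 0) big_ord_recl big_ord1 /cofactor !det_mx11 !mxE /=.
  by rewrite expr0 mul1r expr1 mulN1r mulrN.
have um : mx22 a b c d \is a GRing.unit.
  by rewrite -[_ \is a _]/(_ \in unitmx) unitmxE detm unitr1.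
by exists (FinRing.Unit um) => //; rewrite inE detm.
Qed.

Lemma ofFp_inj : injective ofFp.
Proof.
move=> a b eqab; apply/eqP; rewrite -subr_eq0; apply/negPn/negP => nab.
have := of_FpM charkp (a - b) (a - b)^-1.
have -> : ofFp (a - b) = 0.
  apply: (addIr (ofFp b)); rewrite -(of_FpD charkp) subrK add0r; exact: eqab.
rewrite mulfV // (of_Fp_nat charkp 1) mul0r => /eqP; rewrite oner_eq0.
by [].
Qed.

Lemma poly_Fp_eq0 (q : {poly k}) :
  (size q <= p)%N -> (forall a : 'F_p, q.[ofFp a] = 0) -> q = 0.
Proof.
move=> szq q0; apply/eqP/negPn/negP => nq0.
have p_pr := pcharf_prime charkp.
suffices : (size [seq ofFp a | a : 'F_p] < size q)%N.
  by rewrite size_map -cardE card_Fp // ltnNge szq.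
apply: max_poly_roots nq0 _ _; last first.
  by rewrite map_inj_uniq ?enum_uniq //; apply: ofFp_inj.
by apply/allP=> x /mapP[a _ ->]; apply/rootP.
Qed.

Lemma bin_neq0 N j : (N < p)%N -> (j <= N)%N -> 'C(N, j)%:R != 0 :> k.
Proof.
move=> ltNp lejN; have fact0 : N`!%:R != 0 :> k.
  elim: N ltNp {lejN} => [|N IHN] ltNp; first by rewrite fact0 oner_eq0.
  rewrite factS natrM mulf_neq0 ?IHN ?(ltnW ltNp) //.
  by rewrite -(dvdn_pcharf charkp) gtnNdvd.
by apply: contraNneq fact0 => C0; rewrite -(bin_fact lejN) natrM C0 mul0r.
Qed.

Lemma V_upper_row0 n (g : {'GL_2(p)}) a (j : 'I_n.+1) :
  GLval g = mx22 1 a 0 1 -> V_mx k n.+1 g 0 j = ofFp a ^+ j.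
Proof.
move=> Eg; rewrite V_mx_coef Eg !mxE /= (of_Fp_nat charkp 1) (of_Fp_nat charkp 0).
by rewrite scale0r addr0 expr1n mul1r scale1r -horner_coef0 !hornerE.
Qed.

Lemma V_upper_col0 n (g : {'GL_2(p)}) a (i : 'I_n.+1) :
  GLval g = mx22 1 a 0 1 -> V_mx k n.+1 g i 0 = (i == 0)%:R.
Proof.
move=> Eg; rewrite V_mx_coef Eg !mxE /= (of_Fp_nat charkp 1) (of_Fp_nat charkp 0).
by rewrite scale0r addr0 expr1n mul1r coef1.
Qed.

Lemma V_lower_col0 n (g : {'GL_2(p)}) a (i : 'I_n.+1) :
  GLval g = mx22 1 0 a 1 -> V_mx k n.+1 g i 0 = 'C(n, i)%:R * ofFp a ^+ i.
Proof.
move=> Eg; rewrite V_mx_coef Eg !mxE /= (of_Fp_nat charkp 1) subn0 mulr1.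
rewrite exprDn coef_sum (bigD1 i) //= big1 ?addr0 => [|t nt].
  by rewrite expr1n mul1r exprZn coefMn coefZ coefXn eqxx mulr1 mulr_natl.
rewrite expr1n mul1r exprZn coefMn coefZ coefXn eq_sym (inj_eq val_inj) (negbTE nt).
by rewrite mulr0 mul0rn.
Qed.

(** On columns, F maps V_(m+1) to V_(n+1), and its column 0 is the image of X^m.
    The substitutions Y |-> Y + tX fix X^m, so they fix this image: its entries
    below the top are the coefficients of a polynomial in t, of degree at most
    n < p, that vanishes on F_p.  So F maps X^m to F_00 X^n, and (X + tY)^m to
    F_00 (X + tY)^n.  Comparing coefficients of t determines F, since the binomials
    C(m, j) are nonzero modulo p; if m < n, the coefficient of t^n gives F_00 = 0. *)
Lemma V_hom_entry m n (F : 'M[k]_(n.+1, m.+1)) :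
    (n < p)%N -> (m <= n)%N -> is_hom (V charkp n.+1) (V charkp m.+1) F ->
  forall i j, F i j = if (i == j :> nat) && (m == n) then F 0 0 else 0.
Proof.
move=> ltnp lemn homF; have ltmp := leq_ltn_trans lemn ltnp.
have col0 i : i != 0 -> F i 0 = 0.
  move=> ni; pose q : {poly k} := \poly_(l < n.+1) F (inord l) 0 - (F 0 0)%:P.
  suffices /(congr1 (fun f : {poly k} => f`_i)) : q = 0.
    rewrite coefB coef_poly coefC coef0 ltn_ord inord_val.
    by rewrite (negbTE ni : (i == 0%N :> nat) = false) subr0.
  apply: poly_Fp_eq0 => [|a].
    rewrite (leq_trans (size_polyD _ _)) // geq_max (leq_trans (size_poly _ _)) //.
    by rewrite size_polyN (leq_trans (size_polyC_leq1 _)) // (leq_trans _ ltnp).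
  have [|u uG Eu] := @SL2_elt 1 a 0 1; first by rewrite mulr0 subr0 mulr1.
  have /matrixP /(_ 0 0) := homF u uG; rewrite !mxE => eq00.
  rewrite hornerD hornerN hornerC horner_poly; apply/eqP; rewrite subr_eq0; apply/eqP.
  transitivity (\sum_j V_mx k n.+1 u 0 j * F j 0).
    by apply: eq_bigr => j _; rewrite inord_val (V_upper_row0 _ Eu) mulrC.
  rewrite [LHS]eq00 (bigD1 0) //= big1 ?addr0 => [|l nl].
    by rewrite (V_upper_col0 _ Eu) eqxx mulr1.
  by rewrite (V_upper_col0 _ Eu) (negbTE nl) mulr0.
have row i : \poly_(l < m.+1) (F i (inord l) * 'C(m, l)%:R) =
    (F 0 0 * 'C(n, i)%:R) *: 'X^i.
  apply/eqP; rewrite -subr_eq0; apply/eqP; apply: poly_Fp_eq0 => [|a].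
    rewrite (leq_trans (size_polyD _ _)) // geq_max (leq_trans (size_poly _ _)) //.
    rewrite size_polyN (leq_trans (size_scale_leq _ _)) // size_polyXn.
    exact: leq_trans (ltn_ord i) ltnp.
  have [|u uG Eu] := @SL2_elt 1 0 a 1; first by rewrite mul0r subr0 mulr1.
  have /matrixP /(_ i 0) := homF u uG; rewrite !mxE => eqi0.
  rewrite hornerD hornerN hornerZ hornerXn horner_poly.
  apply/eqP; rewrite subr_eq0; apply/eqP.
  transitivity (\sum_j F i j * V_mx k m.+1 u j 0).
    by apply: eq_bigr => j _; rewrite inord_val (V_lower_col0 _ Eu) mulrA.
  rewrite -[LHS]eqi0 (bigD1 0) //= big1 ?addr0 => [|l nl].
    by rewrite (V_lower_col0 _ Eu) mulrC mulrA.
  by rewrite col0 // mulr0.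
have F00 : m != n -> F 0 0 = 0.
  move=> nmn; have /(congr1 (fun f : {poly k} => f`_n)) := row ord_max.
  rewrite coef_poly coefZ coefXn /= eqxx binn !mulr1 ltnS.
  by rewrite leqNgt ltn_neqAle nmn lemn.
move=> i j; have /(congr1 (fun f : {poly k} => f`_j)) := row i.
rewrite coef_poly coefZ coefXn ltn_ord inord_val => eqF.
have Cn0 : 'C(m, j)%:R != 0 :> k by apply: bin_neq0; rewrite // -ltnS.
apply: (mulIf Cn0); rewrite eqF; case: (eqVneq m n) => [Emn|/F00->].
  rewrite andbT [(j == i :> nat)]eq_sym.
  case: eqP => [Eij|_]; last by rewrite mulr0 mul0r.
  by rewrite mulr1; congr (_ * 'C(_, _)%:R).
by rewrite andbF !mul0r.
Qed.

Lemma V_end n F : (n <= p)%N -> is_hom (V charkp n) (V charkp n) F -> is_scalar_mx F.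
Proof.
case: n F => [|n] F lenp homF.
  by apply/is_scalar_mxP; exists 0; apply/matrixP=> -[].
apply/is_scalar_mxP; exists (F 0 0); apply/matrixP=> i j.
rewrite (V_hom_entry lenp (leqnn n) homF) eqxx andbT !mxE (inj_eq val_inj).
by case: eqP.
Qed.

Lemma V_hom_eq0 m n F : (m < n)%N -> (n <= p)%N ->
  is_hom (V charkp n) (V charkp m) F -> F = 0.
Proof.
case: n F => [|n] F //; case: m F => [|m] F ltmn lenp homF; first by rewrite thinmx0.
apply/matrixP=> i j; rewrite (V_hom_entry lenp (ltnW ltmn) homF) mxE.
by rewrite (ltn_eqF (ltmn : (m < n)%N)) andbF.
Qed.

(** If l and n differ, one of the two factors V_l -> V_n and V_n -> V_l goes from
    the smaller module to the larger one, so it is 0. *)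
Lemma has_mult_V l n : (0 < l <= p)%N -> (n <= p)%N ->
  has_mult (V charkp l) (V charkp n) (l == n).
Proof.
case/andP=> l_gt0 lelp lenp; case: (ltngtP l n) => [ltln|ltnl|<-].
- by apply: has_mult0P => F H _ homH; rewrite (V_hom_eq0 ltln lenp homH) mulmx0.
- by apply: has_mult0P => F H homF _; rewrite (V_hom_eq0 ltnl lelp homF) mul0mx.
exact: has_mult_self.
Qed.

End Homomorphisms.

(** * The decomposition of V_2 (x) V_n *)

Section TensorWithV2.

Local Open Scope ring_scope.
Variables (k : fieldType) (p : nat).
Hypothesis charkp : p \in [pchar k].
Local Notation ofFp := (@of_Fp k p).
Local Notation poly2 := {mpoly k[2]}.

Let lift01 : lift ord0 ord0 = 1 :> 'I_2. Proof. exact: val_inj. Qed.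

Lemma linear_sum_scale (U W : lmodType k) (d : U -> W) (I : finType)
    (a : I -> k) (f : I -> U) :
  linear d -> d (\sum_i a i *: f i) = \sum_i a i *: d (f i).
Proof.
move=> lin; have d0 : d 0 = 0.
  by have := lin (-1) 0 0; rewrite scaleN1r addNr scaleN1r addNr.
by elim/big_rec2: _ => [|i x y _ <-] //; rewrite lin.
Qed.

(** Elements of V_2 (x) V_n are written X (x) f_0 + Y (x) f_1; then [split_mx]
    represents the map V_m -> V_2 (x) V_n, f |-> (d_0 f, d_1 f), and [merge_mx]
    the map V_2 (x) V_n -> V_m, (f_0, f_1) |-> e_0 f_0 + e_1 f_1. *)
Definition split_mx m n (d : 'I_2 -> poly2 -> poly2) : 'M[k]_(2 * n, m) :=
  \matrix_(x, c) (d (mxtens_unindex x).1 'X_[mon c])@_(mon (mxtens_unindex x).2).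

Definition merge_mx m n (e : 'I_2 -> poly2 -> poly2) : 'M[k]_(m, 2 * n) :=
  \matrix_(c, x) (e (mxtens_unindex x).1 'X_[mon (mxtens_unindex x).2])@_(mon c).

Lemma merge_split_mx m m' n (d e : 'I_2 -> poly2 -> poly2) (c : 'I_m) (c' : 'I_m') :
    (0 < n)%N -> (forall s, linear (e s)) ->
    (forall s, d s 'X_[mon c'] \is n.-1.-homog) ->
  (merge_mx m n e *m split_mx m' n d) c c' =
    (\sum_s e s (d s 'X_[mon c']))@_(mon c).
Proof.
move=> n_gt0 lin_e homog_d; rewrite mxE sum_mxtens raddf_sum /=; apply: eq_bigr => s _.
rewrite [in RHS](homog_expand n_gt0 (homog_d s)) linear_sum_scale // raddf_sum /=.
by apply: eq_bigr => b _; rewrite !mxE mxtens_indexK mcoeffZ mulrC.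
Qed.

Lemma V2_mx (g : {'GL_2(p)}) : V_mx k 2 g = map_mx ofFp g.
Proof.
apply/matrixP=> i j; rewrite V_mx_coef // mxE.
case: i => -[|[|//]] ? ; case: j => -[|[|//]] ? /=; rewrite ?expr0 ?expr1 ?mul1r ?mulr1.
all: rewrite coefD coefC coefZ coefX /= ?mulr0 ?mulr1 ?addr0 ?add0r.
all: by congr (ofFp (GLval g _ _)); apply: val_inj.
Qed.

Lemma coef_act n (g : 'M['F_p]_2) (f : poly2) (b : 'I_n) : f \is n.-1.-homog ->
  (act g f)@_(mon b) = \sum_(b' < n) (act g 'X_[mon b'])@_(mon b) * f@_(mon b').
Proof.
move=> homf; have n_gt0 : (0 < n)%N by apply: leq_ltn_trans (ltn_ord b).
rewrite {1}(homog_expand n_gt0 homf) linear_sum_scale; last exact: act_linear.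
by rewrite raddf_sum; apply: eq_bigr => b' _; rewrite /= mcoeffZ mulrC.
Qed.

(** The last hypothesis is the equivariance of f |-> (d_0 f, d_1 f): on V_2 the
    matrix of g is g itself, so g sends (f_0, f_1) to the pair with entry s equal
    to the sum over r of g_sr (g f_r). *)
Lemma split_mx_hom m n (d : 'I_2 -> poly2 -> poly2) :
    (forall s, linear (d s)) ->
    (forall s (c : 'I_m), d s 'X_[mon c] \is n.-1.-homog) ->
    (forall s (g : {'GL_2(p)}) f, g \in SL2 p ->
      d s (act (GLval g) f) = \sum_r ofFp (g s r) *: act (GLval g) (d r f)) ->
  is_hom (tensor (V charkp 2) (V charkp n)) (V charkp m) (split_mx m n d).
Proof.
move=> lin_d homog_d equiv_d g Gg; apply/matrixP=> x c.
case: (mxtens_indexP x) => s b {x}.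
transitivity ((d s (act (GLval g) 'X_[mon c]))@_(mon b)).
  rewrite equiv_d // raddf_sum mxE sum_mxtens; apply: eq_bigr => r _.
  rewrite /= mcoeffZ coef_act // mulr_sumr; apply: eq_bigr => b' _.
  by rewrite tprod_entry V2_mx !mxE mxtens_indexK mulrA.
rewrite actX_expand linear_sum_scale // raddf_sum mxE.
by apply: eq_bigr => c' _; rewrite /= mcoeffZ !mxE mxtens_indexK mulrC.
Qed.

Local Notation X0 := ('X_0 : poly2).
Local Notation X1 := ('X_1 : poly2).

(** The maps f |-> (Yf, -Xf) and (f_0, f_1) |-> d_Y f_0 - d_X f_1, given by their
    components; with the gradient and (f_0, f_1) |-> X f_0 + Y f_1 they form the
    two splittings. *)
Definition koszul (s : 'I_2) (f : poly2) : poly2 :=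
  if s == 0 then X1 * f else - X0 * f.
Definition curl (s : 'I_2) (f : poly2) : poly2 :=
  if s == 0 then mderiv 1 f else - mderiv 0 f.

Lemma act_X (g : 'M['F_p]_2) (s : 'I_2) :
  act g ('X_s : poly2) = \sum_r ofFp (g r s) *: 'X_r.
Proof. by rewrite /act comp_mpolyXU -tnth_nth tnth_mktuple. Qed.

Lemma act_mul (g : 'M['F_p]_2) (f h : poly2) : act g (f * h) = act g f * act g h.
Proof. by rewrite /act rmorphM. Qed.

Lemma actD (g : 'M['F_p]_2) (f h : poly2) : act g (f + h) = act g f + act g h.
Proof. by rewrite /act comp_mpolyD. Qed.

Lemma mderiv_var (s r : 'I_2) : mderiv s ('X_r : poly2) = (r == s)%:R.
Proof.
rewrite mderivX mnm1E; case: eqP => [->|_]; last by rewrite scale0r.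
rewrite scale1r -[RHS]mpolyX0; congr ('X_[_]).
by apply/mnmP=> i; rewrite mnmBE mnm0E subnn.
Qed.

(** The chain rule.  Both sides are linear in f and satisfy the product rule, so it
    suffices to check the variables. *)
Lemma mderiv_act (g : 'M['F_p]_2) s (f : poly2) :
  mderiv s (act g f) = \sum_r ofFp (g s r) *: act g (mderiv r f).
Proof.
pose P f := mderiv s (act g f) = \sum_r ofFp (g s r) *: act g (mderiv r f).
have PM f1 f2 : P f1 -> P f2 -> P (f1 * f2).
  rewrite /P act_mul mderivM => -> ->.
  rewrite mulr_suml mulr_sumr -big_split /=; apply: eq_bigr => r _.
  by rewrite mderivM actD !act_mul scalerDr -scalerAl -scalerAr.
have P1 : P 1.
  rewrite /P /act comp_mpoly1 -[1]mpolyC1 mderivC big1 // => r _.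
  by rewrite mderivC comp_mpoly0 scaler0.
have PX i : P 'X_i.
  rewrite /P act_X (raddf_sum (mderiv s)) (bigD1 s) //= big1 ?addr0 => [|r nr].
    rewrite mderivZ mderiv_var eqxx (bigD1 i) //= big1 ?addr0 => [|r nr].
      by rewrite mderiv_var eqxx /act comp_mpoly1.
    by rewrite mderiv_var eq_sym (negbTE nr) /act comp_mpoly0 scaler0.
  by rewrite mderivZ mderiv_var (negbTE nr) scaler0.
have PXm m : P 'X_[m].
  rewrite mpolyXE_id; apply: (big_ind P P1 PM) => i _.
  elim: (m i) => [|e IHe]; first by rewrite expr0; exact: P1.
  by rewrite exprS; exact: PM (PX i) IHe.
elim/mpolyind: f => [|c m f _ _ Pf].
  rewrite /act comp_mpoly0 mderiv0 big1 // => r _.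
  by rewrite mderiv0 comp_mpoly0 scaler0.
rewrite act_linear mderivD mderivZ PXm Pf scaler_sumr -big_split.
apply: eq_bigr => r _; rewrite mderivD mderivZ act_linear scalerDr !scalerA.
by rewrite mulrC.
Qed.

Lemma curl_linear s : linear (curl s).
Proof.
move=> a f h; rewrite /curl; case: (s == 0); rewrite mderivD mderivZ //.
by rewrite opprD scalerN.
Qed.

Lemma koszul_linear s : linear (koszul s).
Proof. by move=> a f h; rewrite /koszul; case: (s == 0); rewrite mulrDr scalerAr. Qed.

Lemma mdegBU (m : 'X_{1..2}) s : m s != 0%N -> mdeg (m - U_(s))%MM = (mdeg m).-1.
Proof. by rewrite -lep1mP => /submK {2}<-; rewrite mdegD mdeg1 addn1. Qed.

Lemma mderiv_homog s (m : 'X_{1..2}) :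
  mderiv s ('X_[m] : poly2) \is (mdeg m).-1.-homog.
Proof.
rewrite mderivX; have [->|ms] := eqVneq (m s) 0%N; first by rewrite scale0r dhomog0.
by apply: dhomogZ; rewrite dhomogX /= mdegBU.
Qed.

Lemma mulX_mderiv s (m : 'X_{1..2}) :
  'X_s * mderiv s 'X_[m] = (m s)%:R *: 'X_[m] :> poly2.
Proof.
rewrite mderivX; have [->|ms] := eqVneq (m s) 0%N; first by rewrite !scale0r mulr0.
by rewrite -scalerAr -mpolyXD addmC submK // lep1mP.
Qed.

Lemma koszul_homog s (f : poly2) d : f \is d.-homog -> koszul s f \is d.+1.-homog.
Proof.
move=> homf; rewrite /koszul -[d.+1]add1n.
by case: (s == 0); apply: dhomogM => //; rewrite ?rpredN dhomogX /= mdeg1.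
Qed.

Lemma koszul_act (g : 'M['F_p]_2) s (f : poly2) : \det g = 1 ->
  koszul s (act g f) = \sum_r ofFp (g s r) *: act g (koszul r f).
Proof.
move=> detg; have det2 : g 0 0 * g 1 1 = 1 + g 0 1 * g 1 0.
  rewrite -detg (expand_det_row _ 0) big_ord_recl big_ord1 /cofactor !det_mx11 !mxE /=.
  rewrite expr0 mul1r expr1 mulN1r mulrN lift01.
  rewrite (_ : lift 1 0 = 0 :> 'I_2); last exact: val_inj.
  by rewrite subrK.
have detE : (ofFp (g 0 0))%:MP_[2] * (ofFp (g 1 1))%:MP =
    1 + (ofFp (g 0 1))%:MP * (ofFp (g 1 0))%:MP.
  rewrite -!mpolyCM -!(of_FpM charkp) det2 (of_FpD charkp) mpolyCD.
  by rewrite (of_Fp_nat charkp 1) mpolyC1.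
have actN h : act g (- h : poly2) = - act g h by rewrite /act comp_mpolyN.
rewrite big_ord_recl big_ord1 /koszul /= lift01.
rewrite !act_mul actN !act_X !big_ord_recl !big_ord0 lift01 -!mul_mpolyC !addr0.
set u := act g f; move: detE.
set a00 := (_ (g 0 0))%:MP; set a01 := (_ (g 0 1))%:MP.
set a10 := (_ (g 1 0))%:MP; set a11 := (_ (g 1 1))%:MP.
move=> detE.
have [->|->] : s = 0 \/ s = 1.
  by case: s => -[|[|//]] i; [left | right]; apply: val_inj.
  transitivity ((a00 * a11 - a01 * a10) * (X1 * u)); last by rewrite -/a00 -/a01; ring.
  by rewrite detE; ring.
transitivity ((a00 * a11 - a01 * a10) * (- X0 * u)); last by rewrite -/a10 -/a11; ring.
by rewrite detE /=; ring.
Qed.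

Lemma sum_mulX_mderiv n (c : 'I_n.+1) :
  \sum_s 'X_s * mderiv s 'X_[mon c] = n%:R *: ('X_[mon c] : poly2).
Proof.
under eq_bigr => s _ do rewrite mulX_mderiv.
by rewrite -scaler_suml -natr_sum -mdegE mdeg_mon.
Qed.

Lemma sum_mulX_koszul (f : poly2) : \sum_s 'X_s * koszul s f = 0.
Proof.
by rewrite big_ord_recl big_ord1 /koszul /= lift01; ring.
Qed.

Lemma sum_curl_mderiv (f : poly2) : \sum_s curl s (mderiv s f) = 0.
Proof.
by rewrite big_ord_recl big_ord1 /curl /= lift01 mderiv_comm subrr.
Qed.

(** By the product rule, d_Y (Y f) + d_X (X f) is 2 f + (Y d_Y f + X d_X f), and
    the last term is the degree n - 1 times f. *)
Lemma sum_curl_koszul n (c : 'I_n) :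
  \sum_s curl s (koszul s 'X_[mon c]) = n.+1%:R *: ('X_[mon c] : poly2).
Proof.
have n_gt0 : (0 < n)%N by apply: leq_ltn_trans (ltn_ord c).
rewrite big_ord_recl big_ord1 /curl /koszul /=.
rewrite mulNr mderivN opprK !mderivM !mderiv_var !eqxx !mul1r !mulX_mderiv.
have -> : n.+1 = (2 + (mon c 0%R + mon c 1%R))%N.
  have := mdeg_mon c; rewrite mdegE big_ord_recl big_ord1 lift01.
  by move=> ->; rewrite !addSn add0n prednK.
by rewrite !natrD !scalerDl scale1r addrACA [X in _ + X]addrC.
Qed.

(** The gradient and [koszul] together form a square matrix, of size 2n, and the
    merging maps are a left inverse up to the factor n, by Euler's identity.  For
    n = 1 the second summand is V_0, the zero module. *)
Lemma V2_tensor n : (0 < n)%N -> n%:R != 0 :> k ->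
  mx_rsim (tensor (V charkp 2) (V charkp n))
          (dadd_grepr (V charkp n.+1) (V charkp n.-1)).
Proof.
move=> n_gt0 n_neq0.
pose D := split_mx n.+1 n (fun s => mderiv s).
pose K := split_mx n.-1 n koszul.
pose M := merge_mx n.+1 n (fun s f => 'X_s * f).
pose C := merge_mx n.-1 n curl.
have homog_D s (c : 'I_n.+1) : mderiv s ('X_[mon c] : poly2) \is n.-1.-homog.
  by have := mderiv_homog s (mon c); rewrite mdeg_mon.
have homog_K s (c : 'I_n.-1) : koszul s ('X_[mon c] : poly2) \is n.-1.-homog.
  have n1_gt0 : (0 < n.-1)%N by apply: leq_ltn_trans (ltn_ord c).
  suff: koszul s ('X_[mon c] : poly2) \is n.-1.-1.+1.-homog by rewrite (prednK n1_gt0).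
  by apply: koszul_homog; rewrite dhomogX /= mdeg_mon.
have lin_M s : linear (fun f : poly2 => 'X_s * f).
  by move=> a f h; rewrite mulrDr scalerAr.
have mergeE : col_mx M C *m row_mx D K = n%:R%:M.
  rewrite mul_col_row scalar_mx_block; congr block_mx; apply/matrixP=> c c'.
  - rewrite merge_split_mx // sum_mulX_mderiv mcoeffZ mcoeffX (inj_eq (@mon_inj _)) mxE.
    by rewrite mulr_natr eq_sym.
  - by rewrite merge_split_mx // sum_mulX_koszul mcoeff0 mxE.
  - rewrite merge_split_mx //; last exact: curl_linear.
    by rewrite sum_curl_mderiv mcoeff0 mxE.
  rewrite merge_split_mx //; last exact: curl_linear.
  rewrite sum_curl_koszul mcoeffZ mcoeffX (inj_eq (@mon_inj _)) mxE.
  by rewrite mulr_natr eq_sym prednK.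
exists (row_mx D K).
- by rewrite /=; lia.
- rewrite /row_free eqn_leq rank_leq_row /=.
  have := mxrankM_maxr (col_mx M C) (row_mx D K).
  rewrite mergeE mxrank_unit; last by rewrite unitmxE det_scalar unitfE expf_neq0.
  by apply: leq_trans; lia.
suffices : is_hom (tensor (V charkp 2) (V charkp n))
    (dadd_grepr (V charkp n.+1) (V charkp n.-1)) (row_mx D K) by [].
apply/is_hom_row; split; apply: split_mx_hom => // s.
- by move=> a f h; rewrite mderivD mderivZ.
- by move=> g f _; apply: mderiv_act.
- exact: koszul_linear.
by move=> g f; rewrite inE => /eqP detg; apply: koszul_act.
Qed.

End TensorWithV2.

(** * The Clebsch-Gordan rule *)

Section ClebschGordan.

Variables (k : fieldType) (p : nat).
Hypothesis charkp : p \in [pchar k]%R.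
Local Notation V := (V charkp).

Definition clebsch_gordan (i j l : nat) : bool :=
  [&& odd (i + j + l), i + j + l < 2 * p, l < i + j, i < j + l & j < l + i].

(** Apart from the parity of i + j + l, condition (iv) compares l with |i - j|, with
    i + j and with 2p - (i + j).  The indices (i', j') of the four terms have the
    same parity of i' + j', and change |i - j| and i + j by 1.  If l is not |i - j|,
    the comparison with |i' - j'| has the same outcome for all four, and terms with
    the same i' + j' agree; if l = |i - j|, the other comparisons have the same
    outcome for all four, and terms with the same |i' - j'| agree. *)
Lemma clebsch_gordan_rec r i j l :
    0 < i -> 0 < j -> i.+1 < p -> j < p -> 0 < l < p ->
    r + clebsch_gordan i.-1 j l =
      clebsch_gordan i j.+1 l + clebsch_gordan i j.-1 l ->
  r = clebsch_gordan i.+1 j l.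
Proof.
move=> i_gt0 j_gt0 lti ltj /andP[l_gt0 ltl].
have [l_dist|l_ndist] := boolP ((i == j + l) || (j == i + l)).
  have -> : clebsch_gordan i.-1 j l = clebsch_gordan i j.+1 l.
    by apply/and5P/and5P => -[? ? ? ? ?]; split; lia.
  rewrite addnC => /addnI ->; congr (nat_of_bool _).
  by apply/and5P/and5P => -[? ? ? ? ?]; split; lia.
have -> : clebsch_gordan i.-1 j l = clebsch_gordan i j.-1 l.
  by apply/and5P/and5P => -[? ? ? ? ?]; split; lia.
move/addIn->; congr (nat_of_bool _).
by apply/and5P/and5P => -[? ? ? ? ?]; split; lia.
Qed.

Lemma V1_tensor M : mx_rsim (tensor (V 1) M) M.
Proof.
pose f (x : 'I_(rdegree M)) : 'I_(rdegree (tensor (V 1) M)) :=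
  mxtens_index (0%R : 'I_1, x).
apply: (@mx_rsim_reindex _ _ _ _ _ M f id).
- apply: inj_card_bij; last by rewrite !card_ord /= mul1n.
  by move=> x y /(can_inj (@mxtens_indexK _ _)) [].
- by exists id.
move=> g x y _; rewrite tensor_entry [V 1 g _ _]V_mx_coef //= !expr0 mul1r coef1 eqxx.
by rewrite mul1r.
Qed.

Lemma natr_V_neq0 n : 0 < n < p -> n%:R%R != 0%R :> k.
Proof.
by case/andP=> n_gt0 ltnp; rewrite -(dvdn_pcharf charkp) gtnNdvd.
Qed.

Lemma has_mult_degree0 L M : rdegree M = 0 -> @has_mult k _ (SL2 p) L M 0.
Proof.
move=> M0; apply: has_mult0P => F H _ _; apply/matrixP=> a b; rewrite !mxE.
by rewrite big1 // => c; have := ltn_ord c; rewrite {2}M0.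
Qed.

(** Both sides are V_2 (x) V_i (x) V_j. *)
Lemma rsim_V2_tensor_tensor i j : 0 < i < p -> 0 < j < p ->
  mx_rsim (dadd_grepr (tensor (V i.+1) (V j)) (tensor (V i.-1) (V j)))
          (dadd_grepr (tensor (V j.+1) (V i)) (tensor (V j.-1) (V i))).
Proof.
have step a b : 0 < a < p ->
    mx_rsim (dadd_grepr (tensor (V a.+1) (V b)) (tensor (V a.-1) (V b)))
            (tensor (V 2) (tensor (V a) (V b))).
  move=> lta; have [a_gt0 _] := andP lta.
  apply: mx_rsim_trans (mx_rsim_sym (tensorDl _ _ _)) _.
  apply: mx_rsim_trans (tensorA _ _ _).
  apply: rsim_tensor (mx_rsim_refl _); apply: mx_rsim_sym.
  by apply: V2_tensor => //; apply: natr_V_neq0.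
move=> lti ltj; apply: mx_rsim_trans (step i j lti) _.
apply: mx_rsim_trans (mx_rsim_sym (step j i ltj)).
exact: rsim_tensor (mx_rsim_refl _) (tensorC _ _).
Qed.

(** The isomorphism above determines the multiplicities at i + 2 from those at i and
    i + 1; the boundary value at j = p is 0 because p divides the degree of V_p. *)
Lemma has_mult_tensor l i j : 0 < l < p -> i < p -> j <= p ->
  has_mult (V l) (tensor (V i) (V j)) (clebsch_gordan i j l).
Proof.
move=> ltl; have [l_gt0 l_ltp] := andP ltl.
have endV n : n <= p -> forall F, is_hom (V n) (V n) F -> is_scalar_mx F.
  by move=> lenp F; apply: V_end.
have endl := endV l (ltnW l_ltp).
pose P a := a < p ->
  forall b, b <= p -> has_mult (V l) (tensor (V a) (V b)) (clebsch_gordan a b l).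
suffices both a : P a /\ P a.+1.
  by move=> ltip; apply: (both i).1.
elim: a {i j} => [|i [IH0 IH1]]; split=> //.
- move=> _ j _; have -> : clebsch_gordan 0 j l = false by rewrite /clebsch_gordan; lia.
  exact: has_mult_degree0.
- move=> _ j lejp; have [->|j_neqp] := eqVneq j p.
    have -> : clebsch_gordan 1 p l = false by rewrite /clebsch_gordan; lia.
    apply: has_mult_tensor0 => //; first exact: endV.
    + exact: natr_V_neq0.
    + by apply/eqP; rewrite -(dvdn_pcharf charkp).
  apply: has_mult_rsim (mx_rsim_sym (V1_tensor _)) _.
  have -> : clebsch_gordan 1 j l = (l == j) by rewrite /clebsch_gordan; lia.
  by apply: has_mult_V; lia.
move=> lti j lejp; have [->|j_neqp] := eqVneq j p.
  have -> : clebsch_gordan i.+2 p l = false by rewrite /clebsch_gordan; lia.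
  apply: has_mult_tensor0 => //; first exact: endV.
  + exact: natr_V_neq0.
  + by apply/eqP; rewrite -(dvdn_pcharf charkp).
have [->|j_gt0] := posnP j.
  have -> : clebsch_gordan i.+2 0 l = false by rewrite /clebsch_gordan; lia.
  by apply: has_mult_degree0; rewrite /= muln0.
have [r mr] : exists r, has_mult (V l) (tensor (V i.+2) (V j)) r.
  by apply: has_mult_exists.
suffices <- : r = clebsch_gordan i.+2 j l by [].
apply: clebsch_gordan_rec; rewrite ?l_gt0 //; [by lia..|].
have multC a : a <= p ->
    has_mult (V l) (tensor (V a) (V i.+1)) (clebsch_gordan i.+1 a l).
  move=> leap; apply: has_mult_rsim (tensorC _ _) _.
  by apply: IH1 => //; lia.
apply: (has_mult_uniq (L := V l)) => //; last first.
  by apply: has_mult_dadd; apply: multC; lia.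
apply: has_mult_rsim (rsim_V2_tensor_tensor _ _) _; [by lia..|].
by apply: has_mult_dadd mr (IH0 _ _ _) => //; lia.
Qed.

Lemma summand_clebsch_gordan i j l : 0 < i < p -> 0 < j < p -> 0 < l < p ->
  summand (V l) (tensor (V i) (V j)) <-> clebsch_gordan i j l.
Proof.
move=> /andP[_ ltip] /andP[_ ltjp] ltl; have [l_gt0 ltlp] := andP ltl.
have /summandP : has_mult (V l) (tensor (V i) (V j)) (clebsch_gordan i j l).
  by apply: has_mult_tensor => //; apply: ltnW.
rewrite lt0b; apply => // F; exact: V_end (ltnW ltlp).
Qed.

End ClebschGordan.

Theorem lemma4p2 (k : closedFieldType) (p : nat)
    (charkp : p \in [pchar k]%R) (p_gt2 : 2 < p) :
  (forall i j l : nat,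
     1 <= i <= p - 1 -> 1 <= j <= p - 1 -> 1 <= l <= p - 1 ->
     [<-> summand (V charkp l) (tensor (V charkp i) (V charkp j));
          summand (V charkp i) (tensor (V charkp j) (V charkp l));
          summand (V charkp j) (tensor (V charkp l) (V charkp i));
          [/\ i + j + l = 1 %[mod 2], i + j + l < 2 * p,
              l < i + j, i < j + l & j < l + i]])
  /\ (forall n : nat, 1 <= n <= p - 1 -> (A charkp n)^T%R = A charkp n).
Proof.
have range n : 1 <= n <= p - 1 -> 0 < n < p by lia.
split=> [i j l /range lti /range ltj /range ltl|n /range /andP[n_gt0 ltnp]].
  tfae.
  - by rewrite !summand_clebsch_gordan // /clebsch_gordan; lia.
  - by rewrite !summand_clebsch_gordan // /clebsch_gordan; lia.
  - by rewrite !summand_clebsch_gordan // /clebsch_gordan => cg_jli; split; lia.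
  - by case=> *; rewrite summand_clebsch_gordan // /clebsch_gordan; lia.
apply/matrixP=> i j; rewrite !mxE.
have mult (a b : 'I_p.-1) :
    multiplicity (V charkp b.+1) (tensor (V charkp a.+1) (V charkp n)) =
      clebsch_gordan p a.+1 n b.+1.
  have [lta ltb] : a.+1 < p /\ b.+1 < p by have := ltn_ord a; have := ltn_ord b; lia.
  apply: multiplicity_has_mult => // [F|]; first exact: V_end (ltnW ltb).
  by apply: has_mult_tensor => //; apply: ltnW.
by rewrite !mult /clebsch_gordan; congr (nat_of_bool _); lia.
Qed.
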